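(* Let $L,\rho_{\max},q_{\max}>0$, and let $F$, $\delta\in(0,\rho_{\max}]$ and $f(\rho):=F(\rho,1)$ be as in the context. Suppose that $f\in C^2([0,\rho_{\max}];[0,q_{\max}])$ is such that there exists $\rho_{cr}\in(0,\rho_{\max})$ with: (i) $f'(\rho)>0$ for all $\rho\in[0,\rho_{cr})$ and $f'(\rho_{cr})=0$; (ii) $f''(\rho)<0$ for all $\rho\in[0,\rho_{\max}]$; (iii) $f(0)=0$ and $f(\rho)>0$ for all $\rho\in(0,\rho_{\max}]$. Let $\rho^*\in(0,\delta)$ and $k\in(0,1/(L\rho^* ))$ be given constants. For all $x\in[0,L]$ and $w\in C^0([0,L];(0,\rho_{\max}])$ define $$M(w,x)=\frac{1}{1+k\int_0^x (w(s)-\rho^* )\,ds}.$$ Then there exists a non-decreasing function $c:(0,\rho_{\max}]\to(0,q_{\max}]$ such that for every $\rho_0\in C^1([0,L];(0,\rho_{\max}])$ the initial value problem $$\frac{\partial \rho}{\partial t}(t,x)+\frac{\partial}{\partial x}\big(u(t,x)f(\rho(t,x))\big)=0,\quad t\ge 0,\ x\in[0,L],\qquad \rho[0]=\rho_0,$$ with $$u(t,x)=\frac{\min_{z\in[0,L]}\big(f(\rho(t,z))M(\rho[t],z)\big)}{f(\rho(t,x))M(\rho[t],x)},\quad t\ge 0,\ x\in[0,L],$$ has a unique solution $\rho\in C^1(\mathbb{R}_+\times[0,L];(0,\rho_{\max}])$, and this solution satisfies $$\|\rho[t]-\rho^*\|_\infty\le \exp(-\bar c\,t)\,\|\rho_0-\rho^*\|_\infty\quad\text{for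 all } t\ge 0,\qquad \text{where } \bar c=c\Big(\min_{z\in[0,L]}\rho_0(z)\Big),$$ and $$\lim_{t\to+\infty}u(t,x)=1\quad\text{for all } x\in[0,L].$$
   Context: Notation. $\mathbb{R}_+=[0,+\infty)$. For a set $U\subseteq\mathbb{R}^n$ with non-empty interior and $\Omega\subseteq\mathbb{R}$, $C^0(U;\Omega)$ is the class of continuous maps $U\to\Omega$, and $C^k(U;\Omega)$, $k\ge1$, is the class of continuous functions $U\to\Omega$ having continuous derivatives of order $k$ on $U$. For $\rho:I\times[0,L]\to\mathbb{R}$ with $I$ an interval and $t\in I$, $\rho[t]$ denotes the function $x\mapsto\rho(t,x)$ on $[0,L]$. For $\rho\in C^0([0,L];\mathbb{R})$ and $\rho^*\in\mathbb{R}$, $\|\rho-\rho^*\|_\infty:=\max_{0\le x\le L}|\rho(x)-\rho^*|$. Solutions are classical: the PDE holds pointwise. Standing setting. $F\in C^2([0,\rho_{\max}]\times[0,1];[0,q_{\max}])$ satisfies $F(0,l)=F(\rho,0)=0$ for all $(\rho,l)\in[0,\rho_{\max}]\times[0,1]$ and $F(\rho,l)>0$ for all $(\rho,l)\in(0,\rho_{\max}]\times(0,1]$. There exist a continuous function $\tilde l:(0,\rho_{\max}]\to(0,1]$ and a constant $\delta\in(0,\rho_{\max}]$ such that $\frac{\partial F}{\partial l}(\rho,l)>0$ for all $\rho\in(0,\rho_{\max}]$ and $l\in(0,\tilde l(\rho))$; $F(\rho,\tilde l(\rho))=F(\rho,1)$ for all $\rho\in(0,\rho_{\max}]$; and $\tilde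 l(\rho)=1$ for all $\rho\in(0,\delta]$. The constant $\delta$ in the claim is this one, and $f(\rho):=F(\rho,1)$ for $\rho\in[0,\rho_{\max}]$. *)

(* Defs.v *)
From mathcomp Require Import all_boot all_order all_algebra.
From mathcomp Require Import all_classical all_reals all_analysis.

Set Implicit Arguments.
Unset Strict Implicit.
Unset Printing Implicit Defensive.

Import Order.TTheory GRing.Theory Num.Theory.
Import numFieldNormedType.Exports.

Local Open Scope classical_set_scope.
Local Open Scope ring_scope.

Section Calculus.
Context {R : realType}.
Implicit Types (I J : set R) (f : R -> R) (g : R -> R -> R).

(* Derivatives are taken relative to the domain: two-sided at interior points
   of an interval I, one-sided at those endpoints that belong to I. *)
Definition diff_quot f (x y : R) : R := (f y - f x) / (y - x).

Definition derivable_in I f (x : R) : Prop :=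
  cvg (diff_quot f x y @[y --> within I x^']).

Definition derive_in I f (x : R) : R :=
  lim (diff_quot f x y @[y --> within I x^']).

Fixpoint C1d (k : nat) I f : Prop :=
  {within I, continuous f} /\
  if k is k'.+1 then
    (forall x, I x -> derivable_in I f x) /\ C1d k' I (derive_in I f)
  else True.

Definition pderive1 I g (x y : R) : R := derive_in I (fun z => g z y) x.
Definition pderive2 J g (x y : R) : R := derive_in J (g x) y.

Fixpoint C2d (k : nat) I J g : Prop :=
  {within I `*` J, continuous (fun p : R * R => g p.1 p.2)} /\
  if k is k'.+1 then
    (forall x y, I x -> J y ->
       derivable_in I (fun z => g z y) x /\ derivable_in J (g x) y) /\
    C2d k' I J (pderive1 I g) /\ C2d k' I J (pderive2 J g)
  else True.

Definition Cmaps (k : nat) I (Omega : set R) f : Prop :=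
  C1d k I f /\ set_fun I Omega f.

Definition Cmaps2 (k : nat) I J (Omega : set R) g : Prop :=
  C2d k I J g /\ (forall x y, I x -> J y -> Omega (g x y)).

(* Attained extrema; the default value 0 is only returned when the extremum
   is not attained, which does not happen for continuous f and 0 <= L. *)
Definition min_on (L : R) f : R :=
  xget 0 ((f @` `[0, L]) `&` lbound (f @` `[0, L])).
Definition max_on (L : R) f : R :=
  xget 0 ((f @` `[0, L]) `&` ubound (f @` `[0, L])).

Definition sup_norm (L : R) f : R := max_on L (fun x => `|f x|).

End Calculus.

Section Traffic.
Context {R : realType}.

Record standing_flux (rho_max q_max : R) (F : R -> R -> R)
    (ltilde : R -> R) (delta : R) : Prop := StandingFlux {
  flux_C2 : Cmaps2 2 `[0, rho_max] `[0, 1] `[0, q_max] F;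
  flux_0l : forall l, l \in `[0, 1] -> F 0 l = 0;
  flux_r0 : forall r, r \in `[0, rho_max] -> F r 0 = 0;
  flux_gt0 : forall r l, r \in `]0, rho_max] -> l \in `]0, 1] -> 0 < F r l;
  ltilde_C0 : Cmaps 0 `]0, rho_max] `]0, 1] ltilde;
  delta_range : delta \in `]0, rho_max];
  flux_incr : forall r l, r \in `]0, rho_max] -> l \in `]0, ltilde r[ ->
    0 < pderive2 `[0, 1] F r l;
  flux_ltilde : forall r, r \in `]0, rho_max] -> F r (ltilde r) = F r 1;
  ltilde_delta : forall r, r \in `]0, delta] -> ltilde r = 1
}.

Definition Mfun (k rho_star : R) (w : R -> R) (x : R) : R :=
  1 / (1 + k * \int[lebesgue_measure]_(s in `[0, x]) (w s - rho_star)).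

Definition speed (L k rho_star : R) (f : R -> R) (rho : R -> R -> R)
    (t x : R) : R :=
  min_on L (fun z => f (rho t z) * Mfun k rho_star (rho t) z) /
  (f (rho t x) * Mfun k rho_star (rho t) x).

Record classical_solution (L rho_max k rho_star : R) (f rho0 : R -> R)
    (rho : R -> R -> R) : Prop := ClassicalSolution {
  sol_C1 : Cmaps2 1 `[0, +oo[ `[0, L] `]0, rho_max] rho;
  sol_init : forall x, x \in `[0, L] -> rho 0 x = rho0 x;
  sol_pde : let flux t x := speed L k rho_star f rho t x * f (rho t x) in
    forall t x, 0 <= t -> x \in `[0, L] ->
      derivable_in `[0, L] (flux t) x /\
      pderive1 `[0, +oo[ rho t x + pderive2 `[0, L] flux t x = 0
}.

End Traffic.

(* Main.v *)
Require Import Defs.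
From mathcomp Require Import all_boot all_order all_algebra.
From mathcomp Require Import all_classical all_reals all_analysis.
From mathcomp Require Import ring lra.

Import Order.TTheory GRing.Theory Num.Theory.
Import numFieldNormedType.Exports.

Local Open Scope classical_set_scope.
Local Open Scope ring_scope.

Set Implicit Arguments.
Unset Strict Implicit.
Unset Printing Implicit Defensive.

(** The control law makes the closed loop solvable by separation of variables.
For a profile [w] put [m w = min_z (f (w z) * M w z)].  Since
[M w x = 1 / (1 + k * int_0^x (w - rho_star))], the flux produced by the speed is
[m (rho t) * (1 + k * int_0^x (rho t s - rho_star) ds)], and its space derivative
is [k * m (rho t) * (rho t x - rho_star)] ([is_derive_in_flux]).  The conservation
law is therefore equivalent to
  [d/dt (rho t x - rho_star) = - k * m (rho t) * (rho t x - rho_star)],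
a linear ordinary differential equation for each [x] whose rate does not depend
on [x].

Consequently, every solution has the form
[rho t x = rho_star + lam t * (rho0 x - rho_star)] ([solution_is_profile]): the
rate is nonnegative, so a combination of the deviations at two points that
vanishes at time 0 vanishes for ever ([decay_eq0]), and all deviations stay
proportional to the initial ones.  The common factor [lam] satisfies the
autonomous equation [lam' = - G lam * lam] with [lam 0 = 1], where
[G l = k * m (rho_star + l * (rho0 - rho_star))] is continuous (a minimum over a
compact set of a jointly continuous function, [continuous_min_on]) and lies
between two positive constants.  With [lam = expR (- theta)] this becomes
[theta' = p theta] for a continuous [p] with values in some [[a, b]], [0 < a];
separation of variables gives existence and uniqueness, although [p] need not be
Lipschitz: a primitive of [1 / p] is a bijection, and its inverse is the solution
([autonomous_ode], [decay_ode]).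

The decay estimate is the bound [lam t <= expR (- a * t)], where [a] is a lower
bound of [G].  All the profiles [rho_star + l * (rho0 - rho_star)], [0 <= l <= 1],
stay above [min (min rho0) rho_star], so [a] can be computed from the infimum of
[f] to the right of that value, which is non-decreasing in [min rho0]
([inflow_ge], [inf_from_homo]).  Finally [lam t] tends to 0, the profile tends to
the constant [rho_star], and by continuity the numerator and the denominator of
the speed both tend to [f rho_star] ([speed_profile_cvg]). *)

(** * Continuity relative to a set *)

Lemma continuous_within_comp {T U V : topologicalType} (A : set T) (B : set U)
    (g : T -> U) (h : U -> V) :
  {within A, continuous g} -> {within B, continuous h} ->
  (forall x, A x -> B (g x)) -> {within A, continuous (h \o g)}.
Proof.
move=> /subspace_continuousP cg /subspace_continuousP ch gB.
apply/subspace_continuousP => x Ax.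
apply: cvg_comp (ch _ (gB _ Ax)) => S wS.
have H : \forall y \near x, A y -> B (g y) -> S (g y) := cg x Ax _ wS.
change (\forall y \near x, A y -> S (g y)).
by apply: filterS H => y H Ay; apply: H (gB _ Ay).
Qed.

Section Clamp.
Context {R : realType}.
Implicit Types (a b x : R) (f : R -> R).

(** The retraction of the line onto [[a, b]].  Composing with it extends a function
that is continuous on a segment to a continuous function on the whole line, which
spares relative topologies in the parametric problems below. *)
Definition clamp a b x : R := Num.max a (Num.min x b).

Lemma clamp_in a b x : a <= b -> clamp a b x \in `[a, b].
Proof.
by move=> ab; rewrite in_itv /= /clamp le_max lexx /= ge_max ab ge_min lexx orbT.
Qed.

Lemma clamp_id a b x : x \in `[a, b] -> clamp a b x = x.
Proof.
by rewrite in_itv /= => /andP[ax xb]; rewrite /clamp (min_idPl xb) (max_idPr ax).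
Qed.

Lemma continuous_clamp a b : continuous (clamp a b).
Proof.
move=> x; apply: (@continuous_max _ _ (cst a) (fun y => Num.min y b)).
  exact: cvg_cst.
by apply: (@continuous_min _ _ id (cst b)); [exact: cvg_id|exact: cvg_cst].
Qed.

Lemma continuous_clamp_comp a b f : a <= b -> {within `[a, b], continuous f} ->
  continuous (f \o clamp a b).
Proof.
move=> ab cf; apply/continuous_subspace_setT.
apply: (continuous_within_comp (A := setT) (g := clamp a b) _ cf) => [|x _].
  by apply: continuous_subspaceT; exact: continuous_clamp.
exact: clamp_in.
Qed.

End Clamp.

Section WithinContinuity.
Context {R : realType}.
Implicit Types (I J : set R) (f : R -> R).

Lemma within_continuousM {T : topologicalType} (A : set T) (g h : T -> R) :
  {within A, continuous g} -> {within A, continuous h} ->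
  {within A, continuous (fun x => g x * h x)}.
Proof.
move=> /subspace_continuousP cg /subspace_continuousP ch.
by apply/subspace_continuousP => x Ax; apply: cvgM; [exact: cg|exact: ch].
Qed.

Lemma within_continuousV {T : topologicalType} (A : set T) (g : T -> R) :
  (forall x, A x -> g x != 0) -> {within A, continuous g} ->
  {within A, continuous (fun x => (g x)^-1)}.
Proof.
move=> g0 /subspace_continuousP cg.
by apply/subspace_continuousP => x Ax; apply: cvgV; [exact: g0|exact: cg].
Qed.

Lemma within_continuous_affine {T : topologicalType} (A : set T) (g : T -> R) a b :
  {within A, continuous g} -> {within A, continuous (fun x => a + b * g x)}.
Proof.
move=> /subspace_continuousP cg; apply/subspace_continuousP => x Ax.
apply: cvgD; first exact: cvg_cst.
by apply: cvgM; [exact: cvg_cst|exact: cg].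
Qed.

Lemma within_continuous_tensor I J (g h : R -> R) a :
  {within I, continuous g} -> {within J, continuous h} ->
  {within I `*` J, continuous (fun p : R * R => a + g p.1 * h p.2)}.
Proof.
move=> cg ch.
have c1 : {within I `*` J, continuous (fun p : R * R => g p.1)}.
  apply: (continuous_within_comp (A := I `*` J) (g := fst) _ cg) => [|p []//].
  by apply: continuous_subspaceT => p; exact: cvg_fst.
have c2 : {within I `*` J, continuous (fun p : R * R => h p.2)}.
  apply: (continuous_within_comp (A := I `*` J) (g := snd) _ ch) => [|p []//].
  by apply: continuous_subspaceT => p; exact: cvg_snd.
have /within_continuous_affine := within_continuousM c1 c2.
by move=> /(_ a 1); under eq_fun do rewrite mul1r.
Qed.

Lemma within_continuous_section1 I J (g : R -> R -> R) y : J y ->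
  {within I `*` J, continuous (fun p : R * R => g p.1 p.2)} ->
  {within I, continuous (g^~ y)}.
Proof.
move=> Jy cg; apply: (continuous_within_comp (A := I) (g := fun x => (x, y)) _ cg) => //.
apply: continuous_subspaceT => x.
by apply: (@cvg_pair _ _ _ _ (nbhs x) (nbhs y)); [exact: cvg_id|exact: cvg_cst].
Qed.

Lemma within_continuous_section2 I J (g : R -> R -> R) x : I x ->
  {within I `*` J, continuous (fun p : R * R => g p.1 p.2)} ->
  {within J, continuous (g x)}.
Proof.
move=> Ix cg; apply: (continuous_within_comp (A := J) (g := fun y => (x, y)) _ cg) => //.
apply: continuous_subspaceT => y.
by apply: (@cvg_pair _ _ _ _ (nbhs x) (nbhs y)); [exact: cvg_cst|exact: cvg_id].
Qed.

Lemma is_derive_within_continuous (I : set R) f df :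
  (forall x, I x -> is_derive x 1 f (df x)) -> {within I, continuous f}.
Proof.
move=> fI; apply: continuous_in_subspaceT => x; rewrite inE => /fI[dfx _].
exact/differentiable_continuous/derivable1_diffP.
Qed.

End WithinContinuity.

(** * Extrema over a segment *)

Section Extrema.
Context {R : realType}.
Implicit Types (L : R) (f g : R -> R).

Lemma min_onP L f : 0 <= L -> {within `[0, L], continuous f} ->
  exists2 z, z \in `[0, L] & min_on L f = f z /\ forall x, x \in `[0, L] -> f z <= f x.
Proof.
move=> L0 cf; have [c cI cmin] := EVT_min L0 cf.
rewrite /min_on; case: xgetP => [y _ [[z zI <-] lb]|/(_ (f c))[]]; last first.
  by split; [exists c|move=> _ [z zI <-]; exact: cmin].
by exists z => //; split => // x xI; apply: lb; exists x.
Qed.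

Lemma max_onP L f : 0 <= L -> {within `[0, L], continuous f} ->
  exists2 z, z \in `[0, L] & max_on L f = f z /\ forall x, x \in `[0, L] -> f x <= f z.
Proof.
move=> L0 cf; have [c cI cmax] := EVT_max L0 cf.
rewrite /max_on; case: xgetP => [y _ [[z zI <-] ub]|/(_ (f c))[]]; last first.
  by split; [exists c|move=> _ [z zI <-]; exact: cmax].
by exists z => //; split => // x xI; apply: ub; exists x.
Qed.

Lemma eq_min_on L f g : {in `[0, L], f =1 g} -> min_on L f = min_on L g.
Proof.
move=> fg; rewrite /min_on; suff -> : f @` `[0, L] = g @` `[0, L] by [].
by apply: eq_imagel => x xI; apply: fg.
Qed.

(** Tube argument: by compactness of the segment, [h s] is uniformly close to
[h s0] for [s] near [s0], and uniformly close functions have close minima. *)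
Lemma continuous_min_on L (h : R -> R -> R) : 0 <= L ->
  continuous (fun p : R * R => h p.1 p.2) ->
  continuous (fun s => min_on L (h s)).
Proof.
move=> L0 ch s0.
have cs s : {within `[0, L], continuous (h s)}.
  apply: continuous_subspaceT => x.
  by apply: continuous2_cvg (ch (s, x)) _ _; [exact: cvg_cst|exact: cvg_id].
apply/cvgrPdist_le => /= e e0.
have /compact_near_coveringP cov := @segment_compact R 0 L.
have : \forall s \near s0, `[0, L] `<=` (fun x => `|h s0 x - h s x| <= e).
  apply: (cov R (nbhs s0) (fun s x => `|h s0 x - h s x| <= e) _) => x _.
  have e20 : 0 < e / 2 by rewrite divr_gt0.
  have /cvgrPdist_lt/(_ _ e20)/= [[A B] [/= As Bx] AB] := ch (s0, x).
  exists (B, A); first by [].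
  move=> [y s] /= [By As']; have s0A := nbhs_singleton As.
  have := AB (s, y) (conj As' By); have := AB (s0, y) (conj s0A By).
  move=> /= H1 H2.
  have -> : h s0 y - h s y = (h s0 x - h s y) - (h s0 x - h s0 y) by ring.
  rewrite (le_trans (ler_normB _ _)) // (splitr e) addrC.
  by rewrite lerD // ltW.
apply: filterS => s hs.
have [z0 z0I [-> z0min]] := min_onP L0 (cs s0).
have [z zI [-> zmin]] := min_onP L0 (cs s).
have := hs _ zI; have := hs _ z0I; have := z0min _ zI; have := zmin _ z0I.
rewrite !ler_norml => H1 H2 /andP[H3 H4] /andP[H5 H6].
by apply/andP; split; lra.
Qed.

End Extrema.

(** * One-sided derivatives *)

Section DerivIn.
Context {R : realType}.
Implicit Types (I : set R) (f g : R -> R) (x l : R).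

(** The relational counterpart of [derive_in], the only form for which the limit
need not be shown to exist beforehand. *)
Definition is_derive_in I x f l : Prop :=
  diff_quot f x y @[y --> within I x^'] --> l.

(** The convexity of [I] provides points of [I] arbitrarily close to [x] on the
segment from [x] to [y]; limits along this filter are therefore unique. *)
Lemma within_dnbhs_proper I x y : is_interval I -> I x -> I y -> y != x ->
  ProperFilter (within I x^').
Proof.
move=> iI Ix Iy yx; apply: Build_ProperFilter_ex => B /=.
move=> /nbhs_ballP[e /= e0 eB].
pose d := Num.min 1 (e / 2 / `|y - x|).
have yx0 : 0 < `|y - x| by rewrite normr_gt0 subr_eq0.
have d0 : 0 < d by rewrite lt_min ltr01 /= !divr_gt0.
have d1 : d <= 1 by rewrite ge_min lexx.
exists (x + d * (y - x)); apply: eB.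
- rewrite /ball /= opprD addrA subrr sub0r normrN normrM (gtr0_norm d0).
  apply: (@le_lt_trans _ _ (e / 2)); last by rewrite ltr_pdivrMr // ltr_pMr // ltr1n.
  by rewrite -ler_pdivlMr // ge_min lexx orbT.
- rewrite -subr_eq0 addrAC subrr add0r mulf_neq0 //; first exact: lt0r_neq0.
  by rewrite subr_eq0.
- have [xy|xy] := leP x y.
    by apply: (iI x y) => //; apply/andP; split; nra.
  by apply: (iI y x) => //; apply/andP; split; nra.
Qed.

Lemma is_derive_in_eq I x f l : ProperFilter (within I x^') ->
  is_derive_in I x f l -> derive_in I f x = l.
Proof. by move=> PF fl; apply/cvg_lim. Qed.

Lemma is_derive_inP I x f : derivable_in I f x ->
  is_derive_in I x f (derive_in I f x).
Proof. by []. Qed.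

Lemma is_derive_in_derivable I x f l : is_derive_in I x f l -> derivable_in I f x.
Proof. by move=> fl; apply/cvg_ex; exists l. Qed.

Lemma eq_is_derive_in I x f g l : I x -> {in I, f =1 g} ->
  is_derive_in I x f l -> is_derive_in I x g l.
Proof.
move=> Ix fg; apply: cvg_trans; apply: near_eq_cvg.
apply: filterS (withinT _ _) => y Iy.
by rewrite /diff_quot !fg ?inE.
Qed.

Lemma is_derive_is_derive_in I x f l : is_derive x 1 f l -> is_derive_in I x f l.
Proof.
move=> /is_derive1_caratheodory[g [fg cg <-]].
rewrite /is_derive_in; apply: cvg_within_filter.
have cg' : g y @[y --> x^'] --> g x by exact: cvg_within_filter.
apply: cvg_trans cg'; apply: near_eq_cvg.
apply: filterS (withinT _ _) => y /= yx.
by rewrite /diff_quot fg mulfK // subr_eq0.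
Qed.

Lemma is_derive_in_is_derive I x f l : nbhs x I ->
  is_derive_in I x f l -> is_derive x 1 f l.
Proof.
move=> Ix fl; apply/is_derive1_caratheodory.
exists (fun y => if y == x then l else diff_quot f x y); split.
- move=> z; case: eqP => [->|/eqP zx]; first by rewrite !subrr mulr0.
  by rewrite /diff_quot divfK // subr_eq0.
- rewrite /prop_for /continuous_at /= eqxx => B lB.
  have H : \forall y \near x, y != x -> I y -> B (diff_quot f x y) := fl B lB.
  change (\forall y \near x, B (if y == x then l else diff_quot f x y)).
  apply: filterS2 Ix H => y Iy; case: eqP => [_ _|_ /(_ isT Iy) //].
  exact: nbhs_singleton.
- by rewrite eqxx.
Qed.

Lemma is_derive_in_affine I x f l a b : is_derive_in I x f l ->
  is_derive_in I x (fun y => a + b * f y) (b * l).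
Proof.
move=> fl; rewrite /is_derive_in.
have -> : diff_quot (fun y => a + b * f y) x = fun y => b * diff_quot f x y.
  by apply/funext => y; rewrite /diff_quot; ring.
exact: cvgMr.
Qed.

End DerivIn.

Arguments is_derive_in_affine {R I x f l} a b _ : rename.

Lemma is_derive_affine {R : realType} (f : R -> R) (x l a b : R) : is_derive x 1 f l ->
  is_derive x 1 (fun y => a + b * f y) (b * l).
Proof.
move=> /(is_derive_is_derive_in setT)/(is_derive_in_affine a b).
by apply: is_derive_in_is_derive; exact: filterT.
Qed.

(** * Primitives of continuous functions *)

Section Primitive.
Context {R : realType}.
Notation mu := (@lebesgue_measure R).
Implicit Types (a L x y : R) (q w : R -> R).

Lemma continuous_integrable_itv q a y : {within `[a, y], continuous q} ->
  mu.-integrable `[a, y] (EFin \o q).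
Proof.
by move=> cq; apply: continuous_compact_integrable => //; exact: segment_compact.
Qed.

Lemma is_derive_primitive q a x : continuous q -> a < x ->
  is_derive x 1 (fun y => \int[mu]_(s in `[a, y]) q s) (q x).
Proof.
move=> cq ax; have xu : x < x + 1 by rewrite ltrDl.
have iq : mu.-integrable `[a, x + 1] (EFin \o q).
  by apply: continuous_integrable_itv; exact: continuous_subspaceT.
have := @continuous_FTC1 R q (BLeft a) x (x + 1) xu iq.
move=> /(_ ax (cq x))[dF F'].
by apply: DeriveDef; [exact: dF|rewrite -derive1E F'].
Qed.

(** The two-sided fundamental theorem does not apply at the endpoints, and the
integral over [[0, y]] is constant for [y <= 0].  So [w] is extended by clamping and
integrated from [-1]: the resulting primitive is differentiable on both sides at
every point of [[0, L]] and differs from the given one by a constant. *)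
Lemma is_derive_in_integral L w x : 0 <= L -> {within `[0, L], continuous w} ->
  x \in `[0, L] ->
  is_derive_in `[0, L] x (fun y => \int[mu]_(s in `[0, y]) w s) (w x).
Proof.
move=> L0 cw xI; pose v := w \o clamp 0 L.
have cv : continuous v by exact: continuous_clamp_comp.
pose V y := \int[mu]_(s in `[-1, y]) v s.
have x1 : -1 < x by move: xI; rewrite in_itv /= => /andP[? _]; lra.
have vx : v x = w x by rewrite /v /= clamp_id.
have dV := is_derive_in_affine (- V 0) 1
  (is_derive_is_derive_in `[0, L] (is_derive_primitive cv x1)).
rewrite mul1r vx in dV; apply: eq_is_derive_in dV; first exact: xI.
move=> y; rewrite inE /= in_itv /= => /andP[y0 yL].
rewrite mul1r addrC Rintegral_itvB; last 3 first.
- by apply: continuous_integrable_itv; exact: continuous_subspaceT.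
- by rewrite bnd_simp lerN10.
- by rewrite bnd_simp.
rewrite Rintegral_itv_obnd_cbnd.
  apply: eq_Rintegral => s; rewrite inE /= in_itv /= => /andP[s0 sy].
  by rewrite /v /= clamp_id // in_itv /= s0 (le_trans sy).
apply: (@integrableS _ _ _ mu `[0, y]) => //.
- by move=> s /=; rewrite !in_itv /= => /andP[/ltW -> ->].
- by apply: continuous_integrable_itv; exact: continuous_subspaceT.
Qed.

Lemma integral_bounds w y (m M : R) : 0 <= y ->
  {within `[0, y], continuous w} ->
  (forall s, s \in `[0, y] -> m <= w s <= M) ->
  m * y <= \int[mu]_(s in `[0, y]) w s <= M * y.
Proof.
move=> y0 cw wb.
have Ecst (r : R) : \int[mu]_(s in `[0, y]) r = r * y.
  rewrite Rintegral_cst //= lebesgue_measure_itv /= lte_fin.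
  by case: ltgtP y0 => //= [_ _|<- _]; rewrite ?subr0.
have icst (r : R) : mu.-integrable `[0, y] (EFin \o cst r).
  by apply: continuous_integrable_itv; apply: continuous_subspaceT; exact: cst_continuous.
have iw := continuous_integrable_itv cw.
rewrite -!Ecst; apply/andP; split.
- by apply: (@le_Rintegral _ _ _ mu _ (cst m) w) => // s /wb/andP[].
- by apply: (@le_Rintegral _ _ _ mu _ w (cst M)) => // s /wb/andP[].
Qed.

End Primitive.

(** * Scalar differential equations *)

Section AutonomousODE.
Context {R : realType}.
Variables (p : R -> R) (a b : R).
Hypotheses (cp : continuous p) (a0 : 0 < a) (pab : forall s, a <= p s <= b).

Let p_gt0 s : 0 < p s.
Proof. by have /andP[+ _] := pab s; exact: lt_le_trans. Qed.

Let b_gt0 : 0 < b.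
Proof. by have /andP[_] := pab 0; exact: lt_le_trans. Qed.

Let cinvp : continuous (fun s => (p s)^-1).
Proof. by move=> s; apply: cvgV; [rewrite gt_eqF|exact: cp]. Qed.

(* Solving for times in ]-1, +oo[ makes the solution differentiable on both sides
   at t = 0.  As p <= b, the solution started at 0 stays above - b for these times,
   and the base point of the primitive lies strictly below. *)
Let c0 : R := - (b + 2).

(* The separated variable: theta' = p theta means that Phi (theta t) = t. *)
Let Phi x : R := - (\int[lebesgue_measure]_(s in `[c0, 0]) (p s)^-1) +
  1 * \int[lebesgue_measure]_(s in `[c0, x]) (p s)^-1.

Let Phi0 : Phi 0 = 0.
Proof. by rewrite /Phi mul1r addNr. Qed.

Let dPhi x : c0 < x -> is_derive x 1 Phi (p x)^-1.
Proof.
move=> cx; rewrite -[(p x)^-1]mul1r; apply: is_derive_affine.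
exact: is_derive_primitive cinvp cx.
Qed.

Let Phi_MVT x y : c0 < x -> c0 < y ->
  exists2 z, `|z - x| <= `|y - x| & y - x = p z * (Phi y - Phi x).
Proof.
have wlt u v : c0 < u -> u < v ->
    exists2 z, z \in `]u, v[ & v - u = p z * (Phi v - Phi u).
  move=> cu uv; have [w wI||z zI ->] := @MVT R Phi (fun s => (p s)^-1) u v uv.
  - by apply: dPhi; move: wI; rewrite in_itv /= => /andP[uw _]; exact: lt_trans uw.
  - apply: derivable_within_continuous => w wI.
    have cw : c0 < w.
      by move: wI; rewrite in_itv /= => /andP[uw _]; exact: lt_le_trans uw.
    by have [] := dPhi cw.
  - by exists z => //; rewrite mulrA divff ?mul1r // gt_eqF.
move=> cx cy; have [xy|yx|->] := ltgtP x y.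
- have [z + E] := wlt _ _ cx xy; rewrite in_itv /= => /andP[xz zy].
  exists z => //; rewrite (gtr0_norm (x := y - x)) ?subr_gt0 //.
  by rewrite gtr0_norm ?subr_gt0 //; lra.
- have [z + E] := wlt _ _ cy yx; rewrite in_itv /= => /andP[yz zx].
  exists z.
    rewrite (ltr0_norm (x := y - x)) ?subr_lt0 //.
    by rewrite ltr0_norm ?subr_lt0 //; lra.
  by rewrite -opprB E; ring.
- by exists y; rewrite !subrr // mulr0.
Qed.

Let Phi_inj x y : c0 < x -> c0 < y -> Phi x = Phi y -> x = y.
Proof.
move=> cx cy xy; have [z _] := Phi_MVT cy cx.
by rewrite xy subrr mulr0 => /eqP; rewrite subr_eq0 => /eqP.
Qed.

Let Phi_surj t : -1 < t -> exists s, c0 < s /\ Phi s = t.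
Proof.
move=> t1; have b0 := b_gt0; pose u := - (b + 1); pose v := b * (t + 2).
have cu : c0 < u by rewrite /c0 /u; lra.
have v0 : 0 < v by rewrite mulr_gt0 //; lra.
have u0 : u < 0 by rewrite /u; lra.
have c00 : c0 < 0 by exact: lt_trans u0.
have cv : c0 < v by exact: lt_trans v0.
have Pu : Phi u <= -1.
  have [z _] := Phi_MVT c00 cu; rewrite Phi0 !subr0 => E.
  have /andP[_ pb] := pab z; have pz := p_gt0 z; rewrite leNgt; apply/negP => Pu.
  have : 0 < p z * (Phi u + 1) by rewrite mulr_gt0 //; lra.
  by rewrite mulrDr -E mulr1 /u; lra.
have Pv : t <= Phi v.
  have [z _] := Phi_MVT c00 cv; rewrite Phi0 !subr0 => E.
  have /andP[_ pb] := pab z; have := p_gt0 z => pz.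
  have : b * (t + 2) <= b * Phi v.
    apply: (@le_trans _ _ (p z * Phi v)); first by rewrite -E.
    rewrite ler_wpM2r //.
    by rewrite -(pmulr_rge0 _ pz) -E ltW.
  by rewrite ler_pM2l //; lra.
have [||s + <-] := @IVT R Phi u v t (ltW (lt_trans u0 v0)).
- apply: derivable_within_continuous => w wI.
  have cw : c0 < w.
    by move: wI; rewrite in_itv /= => /andP[uw _]; exact: lt_le_trans uw.
  by have [] := dPhi cw.
- by rewrite ge_min le_max Pv orbT andbT (le_trans Pu) // ltW.
- rewrite in_itv /= => /andP[us _]; exists s; split => //.
  exact: lt_le_trans us.
Qed.

(** Existence and uniqueness without a Lipschitz condition.  The solution is the
inverse of a primitive [Phi] of [1 / p]; the bounds on [p] make [Phi]
bi-Lipschitz, with an image that contains ]-1, +oo[.  The mean value theorem writes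
the difference quotients of the inverse as values of [p] at points between [theta t]
and [theta y], which gives its derivative.  Any other solution [theta'] satisfies
[(Phi \o theta')' = 1], so that [Phi (theta' t) = t]. *)
Lemma autonomous_ode : exists theta : R -> R, [/\
  theta 0 = 0,
  forall t : R, 0 <= t -> is_derive t 1 theta (p (theta t)) &
  forall theta' : R -> R, theta' 0 = 0 ->
    {within `[0, +oo[, continuous theta'} ->
    (forall t : R, 0 < t -> is_derive t 1 theta' (p (theta' t))) ->
    forall t, 0 <= t -> theta' t = theta t].
Proof.
pose theta t := xget 0 [set s | c0 < s /\ Phi s = t].
have thetaP t : -1 < t -> c0 < theta t /\ Phi (theta t) = t.
  by move=> /Phi_surj[s sP]; rewrite /theta; case: xgetP => [y _ //|/(_ s)].
exists theta; split.
- have [c E] := thetaP 0 (ltrN10 _); apply: Phi_inj => //.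
    by rewrite /c0; have := b_gt0; lra.
  by rewrite Phi0.
- move=> t t0; have t1 : -1 < t by lra.
  have It : nbhs t `]-1, +oo[%classic.
    by apply: open_nbhs_nbhs; split; [exact: interval_open|rewrite /= in_itv /= andbT].
  apply: (is_derive_in_is_derive It); apply/cvgrPdist_lt => e e0.
  have [ct Et] := thetaP _ t1.
  have /cvgrPdist_lt/(_ _ e0)/nbhs_ballP[d /= d0 dp] := @cp (theta t).
  have db0 : 0 < d / b by rewrite divr_gt0.
  apply/nbhs_ballP; exists (d / b) => //= y yd yt y1.
  have {}y1 : -1 < y by move: y1; rewrite in_itv /= andbT.
  have [cy Ey] := thetaP _ y1.
  have [z zb E] := Phi_MVT ct cy; rewrite Et Ey in E.
  have -> : diff_quot theta t y = p z by rewrite /diff_quot E mulfK // subr_eq0.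
  apply: dp; rewrite /ball /= distrC (le_lt_trans zb) // E normrM gtr0_norm //.
  move: yd; rewrite /ball /= distrC ltr_pdivlMr // mulrC => yd.
  apply: le_lt_trans yd; apply: ler_wpM2r => //.
  by have /andP[] := pab z.
- move=> th th0 cth dth t; rewrite le_eqVlt => /predU1P[<-|t0].
    rewrite th0; have [c E] := thetaP 0 (ltrN10 _).
    by apply: Phi_inj => //; rewrite ?Phi0 // /c0; have := b_gt0; lra.
  have cth' s : {within `[0, s], continuous th}.
    by apply: continuous_subspaceW cth => u /=; rewrite !in_itv /= andbT => /andP[].
  have th_gt0 s : 0 < s -> 0 < th s.
    move=> s0; have [u|z zI] := @MVT R th (p \o th) 0 s s0 _ (cth' s).
      by rewrite in_itv /= => /andP[u0 _]; exact: dth.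
    by rewrite th0 !subr0 => E; rewrite E mulr_gt0 //=.
  have c00 : c0 < 0 by rewrite /c0; have := b_gt0; lra.
  have dPth (s : R) : 0 < s -> is_derive s 1 (Phi \o th) 1.
    move=> s0; have ps : (p (th s))^-1 * p (th s) = 1 by rewrite mulVf // gt_eqF.
    rewrite -[X in is_derive _ _ _ X]ps; apply: is_derive1_comp (dth _ s0).
    by apply: dPhi; exact: lt_trans (th_gt0 _ s0).
  have cPth : {within `[0, t], continuous (Phi \o th)}.
    apply/subspace_continuousP => s sI.
    have /subspace_continuousP/(_ s sI) := cth' t.
    move=> H; apply: (cvg_comp _ _ H).
    have cs : c0 < th s.
      move: sI; rewrite /= in_itv /= => /andP[+ _]; rewrite le_eqVlt => /predU1P[<-|/th_gt0].
        by rewrite th0.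
      exact: lt_trans.
    have [ds _] := dPhi cs.
    have cPhi : {for th s, continuous Phi}.
      by exact/differentiable_continuous/derivable1_diffP.
    exact: cPhi.
  have [u|z _] := @MVT R (Phi \o th) (cst 1) 0 t t0 _ cPth.
    by rewrite in_itv /= => /andP[u0 _]; exact: dPth.
  rewrite /= th0 Phi0 mul1r !subr0 => E.
  have [c E'] := thetaP t (lt_trans (ltrN10 _) t0).
  by apply: Phi_inj => //; [exact: lt_trans (th_gt0 _ t0)|rewrite E].
Qed.

End AutonomousODE.

Section HalfLine.
Context {R : realType}.
Implicit Types (y m g dg : R -> R).
Notation halfline := (`[0, +oo[%classic : set R).

Lemma within_halfline g (t : R) : {within halfline, continuous g} ->
  {within `[0, t], continuous g}.
Proof. by apply: continuous_subspaceW => u /=; rewrite !in_itv /= andbT => /andP[]. Qed.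

Lemma ge0_derive_halfline g dg : {within halfline, continuous g} ->
  (forall t : R, 0 < t -> is_derive t 1 g (dg t)) ->
  (forall t, 0 < t -> 0 <= dg t) -> forall t, 0 <= t -> g 0 <= g t.
Proof.
move=> cg dgP dg0 t; rewrite le_eqVlt => /predU1P[<- //|t0].
have [s|s] := @MVT R g dg 0 t t0 _ (within_halfline cg).
  by rewrite in_itv /= => /andP[s0 _]; exact: dgP.
rewrite in_itv /= => /andP[s0 _] E; rewrite -subr_ge0 E subr0.
by rewrite mulr_ge0 ?dg0 // ltW.
Qed.

Variables (y m : R -> R).
Hypothesis cy : {within halfline, continuous y}.
Hypothesis dy : forall t : R, 0 < t -> is_derive t 1 y (- (m t * y t)).

(** The square has a derivative whose sign depends only on [C - 2 * m t].
Comparison with [C = 0] and with [C] twice a bound of [m] yields the estimates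
below from bounds on [m] alone, without any regularity of [m] in time. *)
Lemma is_derive_sqr_weight (C t : R) : 0 < t ->
  is_derive t 1 (fun s => y s ^+ 2 * expR (C * s))
    ((C - 2 * m t) * (y t ^+ 2 * expR (C * t))).
Proof.
move=> t0; have d1 := dy t0.
have d2 : is_derive t 1 (fun s => expR (C * s)) (expR (C * t) * C).
  apply: (@is_derive1_comp _ expR (fun s => C * s)).
  by apply: is_derive_eq; rewrite /GRing.scale /= mulr1.
have -> : (fun s => y s ^+ 2 * expR (C * s)) = (y * y) * (fun s => expR (C * s)).
  by apply/funext => s; rewrite expr2.
apply: (is_derive_eq (is_deriveM (is_deriveM d1 d1) d2)).
rewrite /GRing.scale /= (_ : (y * y) t = y t * y t) //; ring.
Qed.

Let cy2 C : {within halfline, continuous (fun s => y s ^+ 2 * expR (C * s))}.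
Proof.
apply: within_continuousM.
  by apply: within_continuousM.
apply: continuous_subspaceT => t.
apply: continuous_comp; last exact: continuous_expR.
by apply: cvgM; [exact: cvg_cst|exact: cvg_id].
Qed.

Hypothesis m0 : forall t, 0 < t -> 0 <= m t.

Lemma decay_sqr_le t : 0 <= t -> y t ^+ 2 <= y 0 ^+ 2.
Proof.
move=> t0; rewrite -lerN2.
pose g s := 0 + -1 * (y s ^+ 2 * expR (0 * s)).
suff : g 0 <= g t by rewrite /g !mul0r expR0 !mulr1 !mulN1r !add0r.
apply: (@ge0_derive_halfline g
  (fun s => -1 * ((0 - 2 * m s) * (y s ^+ 2 * expR (0 * s)))) _ _ _ t t0).
- by apply: within_continuous_affine; exact: cy2.
- by move=> s s0; apply: is_derive_affine; exact: is_derive_sqr_weight.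
- move=> s s0; rewrite mulN1r sub0r mulNr opprK.
  apply: mulr_ge0; last exact: mulr_ge0 (sqr_ge0 _) (expR_ge0 _).
  by rewrite mulr_ge0 ?m0.
Qed.

Lemma decay_eq0 : y 0 = 0 -> forall t, 0 <= t -> y t = 0.
Proof.
move=> y0 t t0; have := decay_sqr_le t0; rewrite y0 expr0n /= => H.
by apply/eqP; rewrite -sqrf_eq0 eq_le H sqr_ge0.
Qed.

(** The weighted square [y ^+ 2 * expR (2 * C * t)] is nondecreasing, so [y] never
vanishes, and a continuous function that never vanishes keeps its sign. *)
Lemma decay_gt0 (C : R) : (forall t, 0 < t -> m t <= C) -> 0 < y 0 ->
  forall t, 0 <= t -> 0 < y t.
Proof.
move=> mC y0.
have yneq0 t : 0 <= t -> y t != 0.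
  move=> t0; pose g s := y s ^+ 2 * expR (2 * C * s).
  have : g 0 <= g t.
    apply: (@ge0_derive_halfline g
      (fun s => (2 * C - 2 * m s) * (y s ^+ 2 * expR (2 * C * s))) _ _ _ t t0).
    - exact: cy2.
    - by move=> s s0; exact: is_derive_sqr_weight.
    - move=> s s0; apply: mulr_ge0; last exact: mulr_ge0 (sqr_ge0 _) (expR_ge0 _).
      by rewrite -mulrBr mulr_ge0 ?subr_ge0 ?mC.
  rewrite /g mulr0 expR0 mulr1; apply: contraTneq => ->.
  by rewrite expr0n /= mul0r -ltNge exprn_gt0.
move=> t t0; rewrite lt_neqAle eq_sym yneq0 //= leNgt; apply/negP => yt.
have [|s] := @IVT R y 0 t 0 t0 (within_halfline cy).
  by rewrite ge_min le_max (ltW yt) (ltW y0) orbT.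
rewrite in_itv /= => /andP[s0 _] /eqP.
by rewrite (negPf (yneq0 s s0)).
Qed.

End HalfLine.

(** In the variable [theta = - ln lam] this is [autonomous_ode] for the rate
[fun s => G (expR (- s))]. *)
Lemma decay_ode {R : realType} (G : R -> R) (a b : R) :
  continuous G -> 0 < a -> (forall s, a <= G s <= b) ->
  exists lam : R -> R, [/\ lam 0 = 1,
    forall t : R, 0 <= t -> is_derive t 1 lam (- (G (lam t) * lam t)),
    forall t, 0 <= t -> 0 < lam t <= expR (- a * t) &
    forall lam' : R -> R, lam' 0 = 1 -> {within `[0, +oo[, continuous lam'} ->
      (forall t, 0 <= t -> 0 < lam' t) ->
      (forall t : R, 0 < t -> is_derive t 1 lam' (- (G (lam' t) * lam' t))) ->
      forall t, 0 <= t -> lam' t = lam t].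
Proof.
move=> cG a0 Gab; pose p s := G (expR (- s)).
have cp : continuous p.
  move=> s; apply: (@continuous_comp _ _ _ (fun s => expR (- s)) G); last exact: cG.
  apply: (@continuous_comp _ _ _ -%R expR); last exact: continuous_expR.
  exact: opp_continuous.
have [th [th0 dth thU]] := autonomous_ode cp a0 (fun s => Gab (expR (- s))).
have cth : {within `[0, +oo[, continuous th}.
  apply: (is_derive_within_continuous (df := p \o th)) => t.
  by rewrite /= in_itv /= andbT; exact: dth.
exists (fun t => expR (- th t)); split.
- by rewrite th0 oppr0 expR0.
- move=> t /dth dt; rewrite -mulNr mulrC.
  exact: (@is_derive1_comp _ expR (fun s => - th s)).
- move=> t t0; rewrite expR_gt0 ler_expR mulNr lerN2.
  have [s|s] := @MVT_segment R th (p \o th) 0 t t0 _ (within_halfline (t := t) cth).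
    by rewrite in_itv /= => /andP[/ltW s0 _]; exact: dth.
  rewrite th0 !subr0 => _ ->; apply: ler_wpM2r => //.
  by have /andP[] := Gab (expR (- th s)).
- move=> l l0 cl lpos dl t t0.
  have lnE s : 0 <= s -> expR (- (- ln (l s))) = l s.
    by move=> /lpos ls; rewrite opprK lnK.
  suff <- : - ln (l t) = th t by rewrite lnE.
  apply: (thU (fun s => - ln (l s))) => //.
  + by rewrite l0 ln1 oppr0.
  + have -> : (fun s => - ln (l s)) = (fun s => 0 + -1 * ln (l s)).
      by apply/funext => s; ring.
    apply: within_continuous_affine.
    apply/subspace_continuousP => s sI.
    have ls : 0 < l s by apply: lpos; move: sI; rewrite /= in_itv /= andbT.
    have /subspace_continuousP/(_ s sI) H := cl.
    exact: (cvg_comp _ _ H (continuous_ln ls)).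
  + move=> s s0; have ls := lpos _ (ltW s0).
    have dln : is_derive s 1 (@ln R \o l) ((l s)^-1 * - (G (l s) * l s)).
      exact: is_derive1_comp (is_derive1_ln ls) (dl _ s0).
    apply: (is_derive_eq (is_deriveN dln)).
    by rewrite /p lnE ?ltW //; field; rewrite gt_eqF.
Qed.

(** * Lower bounds of the flux function *)

Section FluxInfimum.
Context {R : realType}.
Variables (rho_max : R) (f : R -> R).
Hypothesis cf : {within `[0, rho_max], continuous f}.
Hypothesis f_gt0 : forall r, r \in `]0, rho_max] -> 0 < f r.

(** The infimum over all densities from [r] up to [rho_max] is non-decreasing in
[r], which the value [f r] itself is not beyond the critical density. *)
Definition inf_from (r : R) : R := inf (f @` `[r, rho_max]).

Let lbf r : r \in `]0, rho_max] ->
  exists2 m, 0 < m & lbound (f @` `[r, rho_max]) m.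
Proof.
rewrite in_itv /= => /andP[r0 rmax].
have cf' : {within `[r, rho_max], continuous f}.
  apply: continuous_subspaceW cf => s /=; rewrite !in_itv /= => /andP[rs ->].
  by rewrite andbT (le_trans (ltW r0)).
have [c] := EVT_min rmax cf'; rewrite in_itv /= => /andP[rc cm] cmin.
exists (f c); first by apply: f_gt0; rewrite in_itv /= cm (lt_le_trans r0).
by move=> _ [s sI <-]; exact: cmin.
Qed.

Lemma inf_from_gt0 r : r \in `]0, rho_max] -> 0 < inf_from r.
Proof.
move=> rI; have [m m0 lb] := lbf rI; apply: (lt_le_trans m0).
apply: lb_le_inf => //; exists (f r), r => //=.
by move: rI; rewrite !in_itv /= lexx => /andP[_ ->].
Qed.

Lemma inf_from_le r s : r \in `]0, rho_max] -> s \in `[r, rho_max] ->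
  inf_from r <= f s.
Proof.
move=> rI sI; have [m _ lb] := lbf rI.
by apply: ge_inf; [exists m|exists s].
Qed.

Lemma inf_from_homo r s : r \in `]0, rho_max] -> s \in `]0, rho_max] -> r <= s ->
  inf_from r <= inf_from s.
Proof.
move=> rI sI rs; apply: lb_le_inf.
  exists (f s), s => //=.
  by move: sI; rewrite !in_itv /= lexx => /andP[_ ->].
move=> _ [u /= uI <-]; apply: inf_from_le => //.
by move: uI; rewrite !in_itv /= => /andP[su ->]; rewrite (le_trans rs).
Qed.

End FluxInfimum.

(** * The feedback law *)

Section Control.
Context {R : realType}.
Variables (L rho_max q_max k rho_star : R) (f : R -> R).
Notation mu := (@lebesgue_measure R).
Hypotheses (L_gt0 : 0 < L) (k_gt0 : 0 < k) (kL : k * (L * rho_star) < 1).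
Hypothesis rho_star_in : rho_star \in `]0, rho_max].
Hypothesis cf : {within `[0, rho_max], continuous f}.
Hypothesis f_gt0 : forall r, r \in `]0, rho_max] -> 0 < f r.
Hypothesis f_le : forall r, r \in `[0, rho_max] -> f r <= q_max.
Implicit Types (w : R -> R).

Let L_ge0 : 0 <= L. Proof. exact: ltW. Qed.

Let rs_gt0 : 0 < rho_star.
Proof. by move: rho_star_in; rewrite in_itv /= => /andP[]. Qed.

Let rs_le : rho_star <= rho_max.
Proof. by move: rho_star_in; rewrite in_itv /= => /andP[]. Qed.

Let rho_max_gt0 : 0 < rho_max. Proof. exact: lt_le_trans rs_le. Qed.

Let den_lo : R := 1 - k * (L * rho_star).
Let den_hi : R := 1 + k * (L * rho_max).

Let den_lo_gt0 : 0 < den_lo. Proof. by rewrite subr_gt0. Qed.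
Let den_hi_gt0 : 0 < den_hi.
Proof. by rewrite addr_gt0 // !mulr_gt0. Qed.

Definition density w := {within `[0, L], continuous w} /\
  (forall x, x \in `[0, L] -> w x \in `]0, rho_max]).

Definition excess w x := \int[mu]_(s in `[0, x]) (w s - rho_star).

Definition scaled_flow w z := f (w z) * Mfun k rho_star w z.

(** As [Mfun k rho_star w 0 = 1], this minimum is the flux that the feedback law
lets in at [x = 0]. *)
Definition inflow w := min_on L (scaled_flow w).

Let cexc w : {within `[0, L], continuous w} ->
  {within `[0, L], continuous (fun s => w s - rho_star)}.
Proof.
move=> cw; have -> : (fun s => w s - rho_star) = (fun s => - rho_star + 1 * w s).
  by apply/funext => s; ring.
exact: within_continuous_affine.
Qed.

(** The lower bound is positive precisely because [k < 1 / (L * rho_star)]: the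
worst case is the empty road, of excess [- L * rho_star]. *)
Lemma excess_bounds w x : density w -> x \in `[0, L] ->
  den_lo <= 1 + k * excess w x <= den_hi.
Proof.
move=> [cw wI]; rewrite in_itv /= => /andP[x0 xL].
have cw' : {within `[0, x], continuous (fun s => w s - rho_star)}.
  apply: continuous_subspaceW (cexc cw) => s /=; rewrite !in_itv /= => /andP[-> sx].
  exact: le_trans xL.
have /andP[lo hi] : - rho_star * x <= excess w x <= rho_max * x.
  apply: integral_bounds => // s; rewrite in_itv /= => /andP[s0 sx].
  have : w s \in `]0, rho_max] by rewrite wI // in_itv /= s0 (le_trans sx).
  have := rs_gt0.
  by rewrite in_itv /= => rs0 /andP[ws wm]; apply/andP; split; lra.
rewrite /den_lo /den_hi -mulrN !lerD2l !ler_pM2l //; apply/andP; split.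
  apply: le_trans lo; rewrite mulNr lerN2 mulrC ler_wpM2r // ltW //.
by apply: (le_trans hi); rewrite mulrC ler_wpM2r // ltW.
Qed.

Lemma continuous_excess w : {within `[0, L], continuous w} ->
  {within `[0, L], continuous (excess w)}.
Proof.
move=> cw; apply: parameterized_integral_continuous => //.
by apply: continuous_integrable_itv; exact: cexc.
Qed.

Lemma MfunE w x : Mfun k rho_star w x = (1 + k * excess w x)^-1.
Proof. by rewrite /Mfun div1r. Qed.

Lemma excess_den_gt0 w x : density w -> x \in `[0, L] -> 0 < 1 + k * excess w x.
Proof. by move=> dw /(excess_bounds dw)/andP[+ _]; exact: lt_le_trans. Qed.

Lemma scaled_flow_gt0 w z : density w -> z \in `[0, L] -> 0 < scaled_flow w z.
Proof.
move=> dw zI; rewrite /scaled_flow MfunE mulr_gt0 ?invr_gt0 ?excess_den_gt0 //.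
by rewrite f_gt0 //; apply dw.2.
Qed.

Lemma continuous_scaled_flow w : density w -> {within `[0, L], continuous (scaled_flow w)}.
Proof.
move=> dw; have [cw wI] := dw; apply: within_continuousM.
  apply: continuous_within_comp cw cf _ => x /wI.
  by rewrite /= !in_itv /= => /andP[/ltW -> ->].
have -> : Mfun k rho_star w = (fun z => (1 + k * excess w z)^-1).
  by apply/funext => z; rewrite MfunE.
apply: within_continuousV => [x xI|]; first by rewrite gt_eqF // excess_den_gt0.
by apply: within_continuous_affine; exact: continuous_excess.
Qed.

Lemma inflowP w : density w -> exists2 z, z \in `[0, L] &
  inflow w = scaled_flow w z /\ forall x, x \in `[0, L] -> scaled_flow w z <= scaled_flow w x.
Proof. by move=> /continuous_scaled_flow cr; exact: min_onP. Qed.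

Lemma inflow_gt0 w : density w -> 0 < inflow w.
Proof. by move=> dw; have [z zI [-> _]] := inflowP dw; exact: scaled_flow_gt0. Qed.

Lemma inflow_le w : density w -> inflow w <= q_max / den_lo.
Proof.
move=> dw; have [z zI [-> _]] := inflowP dw.
have wz := dw.2 _ zI; rewrite /scaled_flow MfunE; apply: ler_pM.
- by rewrite ltW // f_gt0.
- by rewrite invr_ge0 ltW // excess_den_gt0.
- by apply: f_le; move: wz; rewrite !in_itv /= => /andP[/ltW -> ->].
- rewrite lef_pV2 ?posrE ?excess_den_gt0 //.
  by have /andP[] := excess_bounds dw zI.
Qed.

Lemma inflow_ge w r : density w -> r \in `]0, rho_max] ->
  (forall x, x \in `[0, L] -> r <= w x) ->
  inf_from rho_max f r / den_hi <= inflow w.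
Proof.
move=> dw rI wr; have [z zI [-> _]] := inflowP dw.
have wz := dw.2 _ zI; rewrite /scaled_flow MfunE; apply: ler_pM.
- by rewrite ltW // inf_from_gt0.
- by rewrite invr_ge0 ltW.
- apply: inf_from_le => //; move: wz; rewrite !in_itv /= => /andP[_ ->].
  by rewrite wr.
- rewrite lef_pV2 ?posrE ?excess_den_gt0 //.
  by have /andP[] := excess_bounds dw zI.
Qed.

Lemma eq_excess w v x : x \in `[0, L] -> {in `[0, L], w =1 v} ->
  excess w x = excess v x.
Proof.
rewrite in_itv /= => /andP[x0 xL] wv; apply: eq_Rintegral => s.
rewrite inE /= in_itv /= => /andP[s0 sx].
by rewrite wv // in_itv /= s0 (le_trans sx).
Qed.

Lemma eq_scaled_flow w v : {in `[0, L], w =1 v} -> {in `[0, L], scaled_flow w =1 scaled_flow v}.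
Proof.
by move=> wv z zI; rewrite /scaled_flow !MfunE (eq_excess zI wv) wv.
Qed.

Lemma eq_inflow w v : {in `[0, L], w =1 v} -> inflow w = inflow v.
Proof. by move=> wv; apply: eq_min_on; exact: eq_scaled_flow. Qed.

(** The factors [f (w y)] cancel in the flux, which leaves
[inflow w * (1 + k * excess w y)], an affine function of a primitive of
[w - rho_star]. *)
Lemma is_derive_in_flux w x : density w -> x \in `[0, L] ->
  is_derive_in `[0, L] x (fun y => inflow w / scaled_flow w y * f (w y))
    (k * inflow w * (w x - rho_star)).
Proof.
move=> dw xI.
have dE : is_derive_in `[0, L] x (fun y => inflow w + k * inflow w * excess w y)
    (k * inflow w * (w x - rho_star)).
  by apply: is_derive_in_affine; apply: is_derive_in_integral => //; exact: cexc dw.1.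
apply: eq_is_derive_in dE => // y; rewrite inE => yI.
have f0 : f (w y) != 0 by rewrite gt_eqF // f_gt0 //; apply dw.2.
have d0 : 1 + k * excess w y != 0 by rewrite gt_eqF // excess_den_gt0.
by rewrite /scaled_flow MfunE; field; rewrite d0 f0.
Qed.

(** The segment from the constant [rho_star] to [rho0]; solutions move along it. *)
Definition profile (rho0 : R -> R) lam x := rho_star + lam * (rho0 x - rho_star).

Section Family.
Variable rho0 : R -> R.
Hypothesis drho0 : density rho0.

Lemma profile_ge lam x r : lam \in `[0, 1] -> r <= rho_star -> r <= rho0 x ->
  r <= profile rho0 lam x.
Proof. by rewrite in_itv /= /profile => /andP[l0 l1] rr rx; nra. Qed.

Lemma profile_le lam x r : lam \in `[0, 1] -> rho_star <= r -> rho0 x <= r ->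
  profile rho0 lam x <= r.
Proof. by rewrite in_itv /= /profile => /andP[l0 l1] rr rx; nra. Qed.

Lemma density_profile lam : lam \in `[0, 1] -> density (profile rho0 lam).
Proof.
move=> lI; have [c0 I0] := drho0; split.
  by apply: within_continuous_affine; exact: cexc.
move=> x /I0; rewrite !in_itv /= => /andP[x0 xm].
rewrite profile_le // andbT.
apply: (@lt_le_trans _ _ (Num.min rho_star (rho0 x))).
  by rewrite lt_min rs_gt0.
by apply: profile_ge => //; rewrite ge_min lexx ?orbT.
Qed.

Lemma excess_profile lam x : x \in `[0, L] ->
  excess (profile rho0 lam) x = lam * excess rho0 x.
Proof.
rewrite in_itv /= => /andP[x0 xL]; rewrite /excess -RintegralZl //.
  by apply: eq_Rintegral => s _; rewrite /profile; ring.
apply: continuous_integrable_itv.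
apply: continuous_subspaceW (cexc drho0.1) => s /=; rewrite !in_itv /= => /andP[-> sx].
exact: le_trans xL.
Qed.

(** All the arguments are clamped so that the expression is continuous in
[(lam, z)] on the whole plane, while it agrees with [scaled_flow] of the profile on
[[0, 1] * [0, L]]. *)
Definition scaled_flow_ext lam z :=
  f (clamp 0 rho_max (profile (rho0 \o clamp 0 L) (clamp 0 1 lam) z)) /
  (1 + k * clamp 0 1 lam * excess rho0 (clamp 0 L z)).

Lemma scaled_flow_extE lam z : lam \in `[0, 1] -> z \in `[0, L] ->
  scaled_flow_ext lam z = scaled_flow (profile rho0 lam) z.
Proof.
move=> lI zI; rewrite /scaled_flow_ext /scaled_flow MfunE excess_profile //.
rewrite !(clamp_id lI) (clamp_id zI).
rewrite mulrA; congr (f _ / _).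
rewrite /profile /= (clamp_id zI) clamp_id //.
by have := (density_profile lI).2 _ zI; rewrite !in_itv /= => /andP[/ltW -> ->].
Qed.

Lemma scaled_flow_ext_clamp lam : scaled_flow_ext lam = scaled_flow_ext (clamp 0 1 lam).
Proof.
apply/funext => z; rewrite /scaled_flow_ext (@clamp_id _ _ _ (clamp 0 1 lam)) //.
exact: clamp_in.
Qed.

Lemma continuous_scaled_flow_ext : continuous (fun p : R * R => scaled_flow_ext p.1 p.2).
Proof.
have c1 : continuous (fun p : R * R => clamp 0 1 p.1).
  by move=> p; apply: continuous_comp; [exact: cvg_fst|exact: continuous_clamp].
have c2 (h : R -> R) : {within `[0, L], continuous h} ->
    continuous (fun p : R * R => h (clamp 0 L p.2)).
  move=> ch p; apply: (@continuous_comp _ _ _ snd (h \o clamp 0 L)).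
    exact: cvg_snd.
  exact: continuous_clamp_comp.
move=> p; apply: cvgM.
  apply: (@continuous_comp _ _ _ (fun p : R * R =>
    profile (rho0 \o clamp 0 L) (clamp 0 1 p.1) p.2) (f \o clamp 0 rho_max)).
    apply: cvgD; first exact: cvg_cst.
    apply: cvgM; first exact: c1.
    by apply: (c2 (fun x => rho0 x - rho_star)); exact: cexc drho0.1.
  by apply: continuous_clamp_comp => //; exact: ltW.
apply: cvgV.
  have lI := clamp_in p.1 (@ler01 R); have zI := clamp_in p.2 L_ge0.
  rewrite -mulrA -excess_profile // gt_eqF //.
  exact: excess_den_gt0 (density_profile lI) zI.
apply: cvgD; first exact: cvg_cst.
apply: cvgM; first by apply: cvgM; [exact: cvg_cst|exact: c1].
by apply: c2; apply: continuous_excess; exact: drho0.1.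
Qed.

Definition inflow_ext lam := min_on L (scaled_flow_ext lam).

Lemma inflow_extE lam : lam \in `[0, 1] ->
  inflow_ext lam = inflow (profile rho0 lam).
Proof. by move=> lI; apply: eq_min_on => z zI; exact: scaled_flow_extE. Qed.

Lemma inflow_ext_clamp lam :
  inflow_ext lam = inflow (profile rho0 (clamp 0 1 lam)).
Proof. by rewrite -inflow_extE ?clamp_in // /inflow_ext scaled_flow_ext_clamp. Qed.

Lemma continuous_inflow_ext : continuous inflow_ext.
Proof. by apply: continuous_min_on => //; exact: continuous_scaled_flow_ext. Qed.

Lemma scaled_flow_ext0 z : scaled_flow_ext 0 z = f rho_star.
Proof.
rewrite /scaled_flow_ext /profile (@clamp_id _ 0 1) ?in_itv /= ?lexx ?ler01 //.
rewrite mulr0 !mul0r !addr0 divr1 clamp_id // in_itv /= rs_le andbT.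
exact: ltW.
Qed.

Lemma inflow_ext0 : inflow_ext 0 = f rho_star.
Proof.
have c0 : {within `[0, L], continuous (scaled_flow_ext 0)}.
  apply: continuous_subspaceT => z.
  have -> : scaled_flow_ext 0 = cst (f rho_star) by apply/funext => y; exact: scaled_flow_ext0.
  exact: cvg_cst.
by have [z _ [E _]] := min_onP L_ge0 c0; rewrite /inflow_ext E scaled_flow_ext0.
Qed.

End Family.

Lemma classical_density rho0 rho t :
  classical_solution L rho_max k rho_star f rho0 rho -> 0 <= t -> density (rho t).
Proof.
move=> [[[crho _] rhoI] _ _] t0; have tI : `[0, +oo[%classic t by rewrite /= in_itv /= andbT.
split; first exact: within_continuous_section2 tI crho.
by move=> x xI; exact: rhoI.
Qed.

Let proper_space x : x \in `[0, L] -> ProperFilter (within `[0, L] x^').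
Proof.
move=> xI; have I0 : `[0, L]%classic 0 by rewrite /= in_itv /= lexx L_ge0.
have IL : `[0, L]%classic L by rewrite /= in_itv /= lexx L_ge0.
have iI := @interval_is_interval R `[0, L].
have [x0|x0] := eqVneq x 0.
  by apply: (within_dnbhs_proper iI xI IL); rewrite x0 gt_eqF.
by apply: (within_dnbhs_proper iI xI I0); rewrite eq_sym.
Qed.

Let proper_time (t : R) : 0 <= t -> ProperFilter (within `[0, +oo[ t^').
Proof.
move=> t0; apply: (@within_dnbhs_proper R _ t (t + 1)).
- exact: interval_is_interval.
- by rewrite /= in_itv /= t0.
- by rewrite /= in_itv /= andbT addr_ge0.
- by rewrite gt_eqF // ltrDl.
Qed.

(** The conservation law read through [is_derive_in_flux]: at each [x] the deviation
obeys a linear equation, with a rate common to all [x]. *)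
Lemma solution_time_derivative rho0 rho t x :
  classical_solution L rho_max k rho_star f rho0 rho -> 0 <= t -> x \in `[0, L] ->
  is_derive_in `[0, +oo[ t (fun s => rho s x)
    (- (k * inflow (rho t) * (rho t x - rho_star))).
Proof.
move=> sol t0 xI; have dw := classical_density sol t0.
have tI : `[0, +oo[%classic t by rewrite /= in_itv /= andbT.
have [[[_ [der _]] _] _ pde] := sol.
have [dt _] := der t x tI xI.
have [_] := pde t x t0 xI.
rewrite /pderive2 (is_derive_in_eq (proper_space xI) (is_derive_in_flux dw xI)).
by move=> /eqP; rewrite addr_eq0 => /eqP <-; exact: is_derive_inP dt.
Qed.

Lemma profile_solution (rho0 lam : R -> R) : Cmaps 1 `[0, L] `]0, rho_max] rho0 ->
  lam 0 = 1 -> (forall t, 0 <= t -> lam t \in `[0, 1]) ->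
  (forall t : R, 0 <= t ->
     is_derive t 1 lam (- (k * inflow_ext rho0 (lam t) * lam t))) ->
  classical_solution L rho_max k rho_star f rho0 (fun t => profile rho0 (lam t)).
Proof.
move=> [[crho0 [drho0 [cdrho0 _]]] rho0I] lam0 lamI dlam.
have d0 : density rho0 by split.
have itvt (t : R) : `[0, +oo[%classic t -> 0 <= t by rewrite /= in_itv /= andbT.
have clam : {within `[0, +oo[, continuous lam}.
  apply: (is_derive_within_continuous
    (df := fun t => - (k * inflow_ext rho0 (lam t) * lam t))) => t /itvt.
  exact: dlam.
have dt t x : 0 <= t -> is_derive_in `[0, +oo[ t (fun s => profile rho0 (lam s) x)
    (- (k * inflow_ext rho0 (lam t) * lam t) * (rho0 x - rho_star)).
  move=> /dlam/(is_derive_is_derive_in `[0, +oo[) dl.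
  have -> : (fun s => profile rho0 (lam s) x) =
      (fun s => rho_star + (rho0 x - rho_star) * lam s).
    by apply/funext => s; rewrite /profile mulrC.
  by rewrite mulrC; exact: is_derive_in_affine.
have dx t x : x \in `[0, L] -> is_derive_in `[0, L] x (profile rho0 (lam t))
    (lam t * derive_in `[0, L] rho0 x).
  move=> xI; have := is_derive_inP (drho0 x xI).
  move=> /(is_derive_in_affine (rho_star - lam t * rho_star) (lam t)).
  by apply: eq_is_derive_in => // y _; rewrite /profile; ring.
split.
- split; last by move=> t x /itvt/lamI/(density_profile d0)[_]; exact.
  split.
    apply: (within_continuous_tensor (g := lam) (h := fun x => rho0 x - rho_star)) => //.
    exact: cexc.
  split; [|split; split => //].
  + move=> t x /itvt t0 xI; split; first exact: is_derive_in_derivable (dt t x t0).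
    exact: is_derive_in_derivable (dx t x xI).
  + apply: (@subspace_eq_continuous _ _ _ (fun p : R * R =>
      0 + (- (k * inflow_ext rho0 (lam p.1) * lam p.1)) * (rho0 p.2 - rho_star))).
      move=> [t x]; rewrite inE /= => -[/itvt t0 xI].
      by rewrite add0r; exact: esym (is_derive_in_eq (proper_time t0) (dt t x t0)).
    apply: (within_continuous_tensor
      (g := fun t => - (k * inflow_ext rho0 (lam t) * lam t))
      (h := fun x => rho0 x - rho_star)); last exact: cexc.
    apply/subspace_continuousP => t tI.
    have /subspace_continuousP/(_ t tI) cl := clam.
    apply: cvgN; apply: cvgM => //; apply: cvgM; first exact: cvg_cst.
    exact: (cvg_comp _ _ cl (@continuous_inflow_ext _ d0 (lam t))).
  + apply: (@subspace_eq_continuous _ _ _ (fun p : R * R =>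
      0 + lam p.1 * derive_in `[0, L] rho0 p.2)).
      move=> [t x]; rewrite inE /= => -[/itvt t0 xI].
      by rewrite add0r; exact: esym (is_derive_in_eq (proper_space xI) (dx t x xI)).
    exact: (within_continuous_tensor (g := lam)).
- by move=> x _; rewrite /profile lam0 mul1r addrC subrK.
- move=> flux t x t0 xI.
  have dw := density_profile d0 (lamI t t0).
  have dfl := is_derive_in_flux dw xI.
  split; first exact: is_derive_in_derivable dfl.
  rewrite /pderive1 /pderive2 /= (is_derive_in_eq (proper_time t0) (dt t x t0)).
  rewrite (is_derive_in_eq (proper_space xI) dfl) (inflow_extE d0 (lamI t t0)).
  have -> : profile rho0 (lam t) x - rho_star = lam t * (rho0 x - rho_star).
    by rewrite /profile; ring.
  by ring.
Qed.

(** All deviations [rho t x - rho_star] solve the same linear equation, so a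
combination of two of them that vanishes initially vanishes for ever.  If [rho0] is
not constantly equal to [rho_star], the deviation at some point [x'], normalised to
1 at time 0, is the factor [lam]; it remains in [[0, 1]], where its rate is a
function of [lam] alone, and uniqueness for the scalar equation applies.  If
[rho0 = rho_star], all deviations are zero. *)
Lemma solution_is_profile (rho0 : R -> R) (rho : R -> R -> R) (lam : R -> R) : density rho0 ->
  (forall lam' : R -> R, lam' 0 = 1 -> {within `[0, +oo[, continuous lam'} ->
      (forall t : R, 0 <= t -> 0 < lam' t) ->
      (forall t : R, 0 < t ->
         is_derive t 1 lam' (- (k * inflow_ext rho0 (lam' t) * lam' t))) ->
      forall t, 0 <= t -> lam' t = lam t) ->
  classical_solution L rho_max k rho_star f rho0 rho ->
  forall t x, 0 <= t -> x \in `[0, L] -> rho t x = profile rho0 (lam t) x.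
Proof.
move=> d0 lamU sol.
pose m t := k * inflow (rho t).
have m0 t : 0 < t -> 0 <= m t.
  move=> /ltW t0; rewrite mulr_ge0 // ltW // inflow_gt0 //.
  exact: classical_density sol t0.
have mC t : 0 < t -> m t <= k * (q_max / den_lo).
  move=> /ltW t0; rewrite ler_pM2l // inflow_le //.
  exact: classical_density sol t0.
have crho x : x \in `[0, L] -> {within `[0, +oo[, continuous (rho^~ x)}.
  by move=> xI; have [[[c _] _] _ _] := sol; exact: within_continuous_section1 xI c.
have rho_init x : x \in `[0, L] -> rho 0 x = rho0 x by case: sol => _ + _; exact.
pose y x t := rho t x - rho_star.
have cy x : x \in `[0, L] -> {within `[0, +oo[, continuous (y x)}.
  move=> /crho c; have -> : y x = (fun t => - rho_star + 1 * rho t x).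
    by apply/funext => t; rewrite /y; ring.
  exact: within_continuous_affine.
have dy x (t : R) : x \in `[0, L] -> 0 < t -> is_derive t 1 (y x) (- (m t * y x t)).
  move=> xI t0; have It : nbhs t `[0, +oo[%classic.
    apply: filterS (lt_nbhsr t0) => s /=; rewrite !in_itv /= andbT; exact: ltW.
  have H := solution_time_derivative sol (ltW t0) xI.
  have -> : y x = (fun s => - rho_star + 1 * rho s x).
    by apply/funext => s; rewrite /y; ring.
  rewrite -[X in is_derive _ _ _ X]mul1r; apply: is_derive_affine.
  rewrite (_ : - rho_star + 1 * rho t x = rho t x - rho_star); last by ring.
  exact: is_derive_in_is_derive It H.
(* Deviations at two points, combined so as to vanish initially or, with
   [b = 0], to normalise one of them. *)
pose z a b x x' t := (0 + a * y x t) + (0 + b * y x' t).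
have cz a b x x' : x \in `[0, L] -> x' \in `[0, L] ->
    {within `[0, +oo[, continuous (z a b x x')}.
  move=> xI xI'; apply: within_continuousD; apply: within_continuous_affine; exact: cy.
have dz a b x x' (t : R) : x \in `[0, L] -> x' \in `[0, L] -> 0 < t ->
    is_derive t 1 (z a b x x') (- (m t * z a b x x' t)).
  move=> xI xI' t0.
  apply: (is_derive_eq (is_deriveD (is_derive_affine 0 a (dy x t xI t0))
                                   (is_derive_affine 0 b (dy x' t xI' t0)))).
  by rewrite /z; ring.
have [[x' xI' x'0]|rho0E] := pselect (exists2 x', x' \in `[0, L] & rho0 x' != rho_star).
- pose q := (rho0 x' - rho_star)^-1.
  have q0 : rho0 x' - rho_star != 0 by rewrite subr_eq0.
  pose l := z q 0 x' x'.
  have l0 : l 0 = 1.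
    by rewrite /l /z /y rho_init // mul0r !addr0 add0r mulVf.
  have cl := cz q 0 x' x' xI' xI'.
  have dl := dz q 0 x' x' _ xI' xI'.
  have lpos : forall t, 0 <= t -> 0 < l t.
    by apply: (decay_gt0 cl dl mC); rewrite -/l l0.
  have lle t : 0 <= t -> l t <= 1.
    move=> t0; have := decay_sqr_le cl dl m0 t0; rewrite -/l l0.
    by rewrite ler_pXn2r // nnegrE ltW // lpos.
  have rhoE t x : 0 <= t -> x \in `[0, L] -> rho t x = profile rho0 (l t) x.
    move=> t0 xI; pose e := - (q * (rho0 x - rho_star)).
    have := decay_eq0 (cz 1 e x x' xI xI') (fun t => dz 1 e x x' t xI xI') m0 _ t0.
    have -> : z 1 e x x' 0 = 0.
      by rewrite /z /y !rho_init // /e /q; field.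
    move=> /(_ erefl) E; rewrite /profile.
    have -> : l t * (rho0 x - rho_star) = y x t - z 1 e x x' t.
      by rewrite /l /z /e; ring.
    by rewrite E /y; ring.
  move=> t x t0 xI; suff <- : l t = lam t by exact: rhoE.
  apply: (lamU l l0 cl lpos _ t t0) => s s0.
  have sI : l s \in `[0, 1] by rewrite in_itv /= lle ?ltW ?lpos // ltW.
  rewrite (inflow_extE d0 sI) -(@eq_inflow (rho s)).
    exact: dl.
  by move=> u uI; exact: rhoE (ltW s0) uI.
- move=> t x t0 xI; have rho0x : rho0 x = rho_star.
    by apply/eqP/negPn/negP => n; apply: rho0E; exists x.
  have yx0 : y x 0 = 0 by rewrite /y rho_init // rho0x subrr.
  have := decay_eq0 (cy x xI) (fun t => dy x t xI) m0 yx0 t0.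
  by rewrite /profile rho0x subrr mulr0 addr0 /y => /eqP; rewrite subr_eq0 => /eqP.
Qed.

(** Existence, uniqueness and decay of the factor [lam] are those of [decay_ode] for
the rate [k * inflow_ext rho0], whose bounds are [a] and the bound of
[inflow_le]. *)
Lemma control_solution rho0 (a : R) : Cmaps 1 `[0, L] `]0, rho_max] rho0 -> 0 < a ->
  (forall l, l \in `[0, 1] -> a <= k * inflow (profile rho0 l)) ->
  exists lam : R -> R, [/\
    classical_solution L rho_max k rho_star f rho0 (fun t => profile rho0 (lam t)),
    forall rho, classical_solution L rho_max k rho_star f rho0 rho ->
      forall t x, 0 <= t -> x \in `[0, L] -> rho t x = profile rho0 (lam t) x &
    forall t, 0 <= t -> 0 < lam t <= expR (- a * t)].
Proof.
move=> C1rho0 a0 alow.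
have d0 : density rho0 by case: C1rho0 => [[c _] I].
have Gab s : a <= k * inflow_ext rho0 s <= k * (q_max / den_lo).
  rewrite inflow_ext_clamp //; have sI := clamp_in s (@ler01 R).
  by rewrite alow //= ler_pM2l // inflow_le //; exact: density_profile.
have cG : continuous (fun s => k * inflow_ext rho0 s).
  move=> s; apply: cvgM; first exact: cvg_cst.
  exact: continuous_inflow_ext.
have [lam [lam0 dlam lamb lamU]] := decay_ode cG a0 Gab.
exists lam; split => //.
- apply: profile_solution => // t t0; have /andP[l0 l1] := lamb t t0.
  rewrite in_itv /= ltW //= (le_trans l1) // expR_le1 mulNr oppr_le0.
  by rewrite mulr_ge0 // ltW.
- by move=> rho; exact: solution_is_profile.
Qed.

Lemma sup_norm_profile rho0 l e : density rho0 -> 0 <= l <= e ->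
  sup_norm L (fun x => profile rho0 l x - rho_star) <=
  e * sup_norm L (fun x => rho0 x - rho_star).
Proof.
move=> d0 /andP[l0 le]; rewrite /sup_norm.
have cn (g : R -> R) : {within `[0, L], continuous g} ->
    {within `[0, L], continuous (fun x => `|g x|)}.
  move=> /subspace_continuousP cg; apply/subspace_continuousP => x xI.
  by apply: cvg_norm; exact: cg.
have c1 : {within `[0, L], continuous (fun x => `|profile rho0 l x - rho_star|)}.
  by apply/cn/cexc/within_continuous_affine/cexc; exact: d0.1.
have c2 : {within `[0, L], continuous (fun x => `|rho0 x - rho_star|)}.
  by apply/cn/cexc; exact: d0.1.
have [x xI [-> _]] := max_onP L_ge0 c1.
have [y yI [-> ymax]] := max_onP L_ge0 c2.
rewrite /profile addrC addKr normrM (ger0_norm l0).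
by apply: ler_pM => //; exact: ymax.
Qed.

(** On the profiles the speed is the quotient of [inflow_ext] by [scaled_flow_ext];
both are continuous at [lam = 0], with the common value [f rho_star]. *)
Lemma speed_profile_cvg rho0 (lam : R -> R) x : density rho0 ->
  (forall t, 0 <= t -> lam t \in `[0, 1]) -> lam t @[t --> +oo] --> 0 ->
  x \in `[0, L] ->
  speed L k rho_star f (fun t => profile rho0 (lam t)) t x @[t --> +oo] --> (1 : R).
Proof.
move=> d0 lamI lam0 xI.
have frs : f rho_star != 0 by rewrite gt_eqF // f_gt0.
have speedE t : 0 <= t ->
    inflow_ext rho0 (lam t) / scaled_flow_ext rho0 (lam t) x =
    speed L k rho_star f (fun t => profile rho0 (lam t)) t x.
  by move=> /lamI tI; rewrite inflow_extE // scaled_flow_extE.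
have H : inflow_ext rho0 (lam t) / scaled_flow_ext rho0 (lam t) x @[t --> +oo] --> (1 : R).
  rewrite -(divff frs); apply: cvgM.
    rewrite -[X in _ --> X](inflow_ext0 rho0).
    by apply: cvg_comp lam0 _; exact: continuous_inflow_ext.
  apply: cvgV => //; rewrite -[X in _ --> X](scaled_flow_ext0 rho0 x).
  apply: (@cvg_comp _ _ _ (fun t => (lam t, x)) (fun p : R * R => scaled_flow_ext rho0 p.1 p.2)
    _ (nbhs (0, x))); last exact: (@continuous_scaled_flow_ext _ d0 (0, x)).
  by apply: (@cvg_pair _ _ _ _ (nbhs (0 : R)) (nbhs x)); [exact: lam0|exact: cvg_cst].
apply: cvg_trans H; apply: near_eq_cvg.
by apply: filterS (nbhs_pinfty_ge (num_real 0)) => t; exact: speedE.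
Qed.

End Control.

Theorem theorem3p1 (R : realType) (L rho_max q_max : R)
    (L_gt0 : 0 < L) (rho_max_gt0 : 0 < rho_max) (q_max_gt0 : 0 < q_max)
    (F : R -> R -> R) (ltilde : R -> R) (delta : R)
    (hF : standing_flux rho_max q_max F ltilde delta)
    (f : R -> R) (hf : forall r, r \in `[0, rho_max] -> f r = F r 1)
    (f_C2 : Cmaps 2 `[0, rho_max] `[0, q_max] f)
    (f_shape : exists rho_cr, [/\ rho_cr \in `]0, rho_max[,
       (forall r, r \in `[0, rho_cr[ -> 0 < derive_in `[0, rho_max] f r),
       derive_in `[0, rho_max] f rho_cr = 0,
       (forall r, r \in `[0, rho_max] ->
          derive_in `[0, rho_max] (derive_in `[0, rho_max] f) r < 0) &
       f 0 = 0 /\ (forall r, r \in `]0, rho_max] -> 0 < f r)])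
    (rho_star k : R) (rho_star_range : rho_star \in `]0, delta[)
    (k_range : k \in `]0, 1 / (L * rho_star)[) :
  exists c : R -> R,
    [/\ set_fun `]0, rho_max] `]0, q_max] c,
        (forall r s, r \in `]0, rho_max] -> s \in `]0, rho_max] ->
           r <= s -> c r <= c s) &
        forall rho0 : R -> R, Cmaps 1 `[0, L] `]0, rho_max] rho0 ->
        exists rho : R -> R -> R,
          [/\ classical_solution L rho_max k rho_star f rho0 rho,
              (forall rho' : R -> R -> R,
                 classical_solution L rho_max k rho_star f rho0 rho' ->
                 forall t x, 0 <= t -> x \in `[0, L] -> rho' t x = rho t x),
              (forall t, 0 <= t ->
                 sup_norm L (fun x => rho t x - rho_star) <=
                 expR (- c (min_on L rho0) * t) *
                 sup_norm L (fun x => rho0 x - rho_star)) &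
              (forall x, x \in `[0, L] ->
                 speed L k rho_star f rho t x @[t --> +oo] --> (1 : R))]].
Proof.
have [cf0 fI] := f_C2; have cf : {within `[0, rho_max], continuous f} := cf0.1.
have f_gt0 : forall r, r \in `]0, rho_max] -> 0 < f r by case: f_shape => ? [_ _ _ _ []].
have f_le r : r \in `[0, rho_max] -> f r <= q_max.
  by move=> /fI /=; rewrite in_itv /= => /andP[].
have [rs0 rsd] : 0 < rho_star /\ rho_star < delta.
  by move: rho_star_range; rewrite in_itv /= => /andP[].
have rsI : rho_star \in `]0, rho_max].
  have := delta_range hF; rewrite !in_itv /= rs0 => /andP[_ dm].
  by rewrite (le_trans (ltW rsd)).
have [k0 kL] : 0 < k /\ k * (L * rho_star) < 1.
  by move: k_range; rewrite in_itv /= => /andP[k0]; rewrite ltr_pdivlMr ?mulr_gt0.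
have Lrs0 : 0 <= L by exact: ltW.
have hi0 : 0 < 1 + k * (L * rho_max) by rewrite addr_gt0 // !mulr_gt0.
have minI r : r \in `]0, rho_max] -> Num.min r rho_star \in `]0, rho_max].
  move: rsI; rewrite !in_itv /= => /andP[_ rm] /andP[r0 _].
  by rewrite lt_min r0 rs0 ge_min rm orbT.
pose rate r := k * (inf_from rho_max f (Num.min r rho_star) / (1 + k * (L * rho_max))).
have rate_gt0 r : r \in `]0, rho_max] -> 0 < rate r.
  by move=> /minI rI; rewrite mulr_gt0 // divr_gt0 // inf_from_gt0.
(* The truncation at q_max only serves to keep the values in ]0, q_max]. *)
exists (fun r => Num.min q_max (rate r)); split.
- by move=> r rI /=; rewrite in_itv /= lt_min q_max_gt0 rate_gt0 // ge_min lexx.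
- move=> r s rI sI rs; rewrite le_min ge_min lexx /= ge_min; apply/orP; right.
  rewrite ler_pM2l // ler_pM2r ?invr_gt0 //.
  apply: inf_from_homo => //; [exact: minI|exact: minI|].
  by rewrite le_min !ge_min rs lexx orbT.
- move=> rho0 C1; have d0 : density L rho_max rho0 by case: C1 => [[c _] I].
  have [z zI [minE zmin]] := min_onP Lrs0 d0.1.
  have mI : min_on L rho0 \in `]0, rho_max] by rewrite minE; exact: d0.2.
  set a := Num.min _ _.
  have a0 : 0 < a by rewrite /a lt_min q_max_gt0 rate_gt0.
  have [|lam [sol uniq lamb]] := control_solution L_gt0 k0 kL rsI cf f_gt0 f_le C1 a0.
    move=> l lI; apply: (@le_trans _ _ (rate (min_on L rho0))).
      by rewrite /a ge_min lexx orbT.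
    rewrite ler_pM2l //; apply: inflow_ge => //.
    + exact: density_profile.
    + exact: minI.
    + move=> x xI; apply: profile_ge => //; first by rewrite ge_min lexx orbT.
      by rewrite ge_min minE zmin.
  have lamI t : 0 <= t -> lam t \in `[0, 1].
    move=> t0; have /andP[l0 l1] := lamb t t0; rewrite in_itv /= ltW //=.
    by rewrite (le_trans l1) // expR_le1 mulNr oppr_le0 mulr_ge0 // ltW.
  exists (fun t => profile rho_star rho0 (lam t)); split => //.
  + move=> t t0; apply: (sup_norm_profile (rho_max := rho_max)) => //.
    by have /andP[/ltW -> ->] := lamb t t0.
  + move=> x xI; apply: (speed_profile_cvg (rho_max := rho_max)) => //.
    apply: (@squeeze_cvgr _ _ _ _ (cst 0) (fun t => expR (- a * t))).
    * apply: filterS (nbhs_pinfty_ge (num_real 0)) => t t0.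
      by have /andP[/ltW l0 l1] := lamb t t0; apply/andP.
    * exact: cvg_cst.
    * have -> : (fun t => expR (- a * t)) = (fun x => expR (- x)) \o (fun t => a * t).
        by apply/funext => t; rewrite /= mulNr.
      apply: cvg_comp (@cvgr_expR R).
      apply: gt0_cvgMry => //; exact: cvg_id.
Qed.
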